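(* Let $N\ge1$, $\lambda>0$, $B_1=\{x\in\mathbb{R}^N:\|x\|_2<1\}$, and let $u_0$ be a continuous function on $\overline{B_1}$ with $0\le u_0<1$ that is radially symmetric and radially decreasing (i.e. $u_0=u_0(r)$, $r=\|x\|_2$, with $u_0'(r)\le0$). Let $u$ be the solution of $$u_t-\Delta u=\frac{\lambda}{(1-u)^2\left(1+\int_{B_1}\frac{dx}{1-u}\right)^2}\ \text{ in } B_1\times(0,T),\qquad u=0\ \text{ on }\partial B_1\times(0,T),\qquad u(x,0)=u_0(x),\ x\in B_1,$$ and suppose that $u$ quenches in finite time $T_q<\infty$. Let $M(t):=\max_{x\in\overline{B_1}}u(x,t)=u(0,t)$. Then there is a positive constant $\widehat{C}$, independent of time $t$, such that $$M(t)\ge 1-\widehat{C}\,(T_q-t)^{1/3}\qquad\text{for } 0<t<T_q.$$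
   Context: The parabolic problem has a local-in-time solution, which is radial ($u=u(r,t)$, $u_r(0,t)=0$) and decreasing in $r$; it exists as long as $u<1$ and ceases to exist once $u$ reaches $1$. The solution quenches in finite time $0<T_q<\infty$ if there exist $x^*$ and sequences $x_n\in B_1$, $t_n\in(0,\infty)$ with $x_n\to x^*$, $t_n\to T_q$ and $u(x_n,t_n)\to1^-$. *)

(* Defs.v *)
From HB Require Import structures.
From mathcomp Require Import all_boot all_order all_algebra.
From mathcomp Require Import all_classical all_reals all_analysis.
Set Implicit Arguments.
Unset Strict Implicit.
Unset Printing Implicit Defensive.
Import Order.TTheory GRing.Theory Num.Theory.
Import numFieldNormedType.Exports.
Local Open Scope classical_set_scope.
Local Open Scope ring_scope.

(* MathComp-Analysis has Lebesgue measure on the line, binary products of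
   sigma-finite measures, and the product sigma-algebra on [n.-tuple T], but no
   Lebesgue measure in dimension n. It is built here as an iterated product,
   transported to tuples along (x, z) |-> x :: z. *)
Section lebesgue_measure_n.
Context (R : realType).
Local Notation mR := (measurableTypeR R).

Definition cons_pair (n : nat) (p : mR * n.-tuple mR) : n.+1.-tuple mR :=
  [the n.+1.-tuple mR of p.1 :: p.2].

Definition uncons_tuple (n : nat) (z : n.+1.-tuple mR) : mR * n.-tuple mR :=
  (thead z, [tuple of behead z]).

Lemma measurable_cons_pair (n : nat) : measurable_fun setT (@cons_pair n).
Proof. exact: measurable_cons. Qed.

Lemma measurable_uncons_tuple (n : nat) :
  measurable_fun setT (@uncons_tuple n).
Proof.
apply/measurable_fun_pairP; split.
  exact: (@measurable_tnth _ mR n.+1 ord0).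
exact: measurable_behead.
Qed.

Lemma cons_pairK (n : nat) : cancel (@cons_pair n) (@uncons_tuple n).
Proof.
move=> [x z]; rewrite /uncons_tuple /cons_pair; congr (_, _).
by apply: val_inj.
Qed.

Section step.
Context (n : nat) (mu : {sigma_finite_measure set (n.-tuple mR) -> \bar R}).

Definition lebesgue_step : set (n.+1.-tuple mR) -> \bar R :=
  pushforward (lebesgue_measure \x mu)%E (@cons_pair n).

HB.instance Definition _ := Measure.copy lebesgue_step
  (measure_function_pushforward__canonical__measure_function_Measure
     (lebesgue_measure \x mu)%E (@measurable_cons_pair n)).

Let lebesgue_step_sigma_finite : sigma_finite setT lebesgue_step.
Proof.
have /sigma_finiteP[F [TF ndF Foo]] :=
  sigma_finiteT (@lebesgue_measure R : {measure set mR -> \bar R}).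
have /sigma_finiteP[G [TG ndG Goo]] := sigma_finiteT mu.
exists (fun k => @uncons_tuple n @^-1` (F k `*` G k)).
  rewrite -preimage_bigcup (_ : \bigcup_i (F i `*` G i) = setT).
    by rewrite preimage_setT.
  apply/seteqP; split=> // -[x z] _.
  have [i _ Fix] : (\bigcup_i F i) x by rewrite -TF.
  have [j _ Gjz] : (\bigcup_i G i) z by rewrite -TG.
  exists (maxn i j) => //; split => /=.
    by move: x Fix; exact/subsetPset/ndF/leq_maxl.
  by move: z Gjz; exact/subsetPset/ndG/leq_maxr.
move=> k; have [mF Fk] := Foo k; have [mG Gk] := Goo k.
have mFG := measurableX mF mG; split.
  by rewrite -[X in measurable X]setTI; exact: measurable_uncons_tuple.
rewrite /lebesgue_step /pushforward -comp_preimage.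
rewrite (_ : uncons_tuple (n:=n) \o _ = id) ?preimage_id; last first.
  by apply/funext => p; exact: cons_pairK.
by rewrite product_measure1E// lte_mul_pinfty// ge0_fin_numE.
Qed.

HB.instance Definition _ := Measure_isSigmaFinite.Build _ _ _
  lebesgue_step lebesgue_step_sigma_finite.

End step.

Fixpoint lebesgue_measure_n (n : nat) :
    {sigma_finite_measure set (n.-tuple mR) -> \bar R} :=
  match n with
  | 0 => [the {sigma_finite_measure set (0.-tuple mR) -> \bar R} of
            \d_([tuple] : 0.-tuple mR)]
  | n'.+1 => [the {sigma_finite_measure set (n'.+1.-tuple mR) -> \bar R} of
            lebesgue_step (lebesgue_measure_n n')]
  end.

Lemma lebesgue_measure_n_box (n : nat) (A : 'I_n -> set mR) :
  (forall i, measurable (A i)) ->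
  lebesgue_measure_n n [set z | forall i, A i (tnth z i)] =
    (\prod_(i < n) (lebesgue_measure (A i) : \bar R))%E.
Proof.
elim: n A => [|n IHn] A mA.
  by rewrite big_ord0/= diracE mem_set// => -[].
have mbox : measurable [set z : n.-tuple mR | forall i, A (lift ord0 i) (tnth z i)].
  rewrite (_ : [set z | _] =
      \bigcap_(i in [set: 'I_n]) (fun z => tnth z i) @^-1` A (lift ord0 i)).
    apply: fin_bigcap_measurable => // i _; rewrite -[X in measurable X]setTI.
    exact: measurable_tnth.
  by apply/seteqP; split=> [z Az i _|z Az i]; [exact: Az|exact: (Az i I)].
rewrite big_ord_recl -IHn//= /lebesgue_step /pushforward -product_measure1E//.
congr (_ _); apply/seteqP; split=> -[x z] /=.
  move=> Axz; split; first exact: (Axz ord0).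
  by move=> i; have := Axz (lift ord0 i); rewrite tnthS.
move=> [Ax Az] i; case: (unliftP ord0 i) => [j ->|->]; last by [].
by rewrite tnthS.
Qed.

End lebesgue_measure_n.

Section pde_notions.
Context (R : realType) (N : nat).

(* The norm that ['rV[R]_N] carries in the library is the sup norm; the balls
   below are Euclidean. The topologies agree. *)
Definition enorm (x : 'rV[R]_N) : R := Num.sqrt (\sum_(i < N) x 0 i ^+ 2).

Definition unit_ball : set 'rV[R]_N := [set x | enorm x < 1].
Definition closed_unit_ball : set 'rV[R]_N := [set x | enorm x <= 1].
Definition unit_sphere : set 'rV[R]_N := [set x | enorm x = 1].

Definition row_of_tuple (z : N.-tuple (measurableTypeR R)) : 'rV[R]_N :=
  \row_i (tnth z i : R).

Definition ball_integral (f : 'rV[R]_N -> R) : R :=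
  Rintegral (@lebesgue_measure_n R N) (row_of_tuple @^-1` unit_ball)
    (f \o row_of_tuple).

Definition partial (i : 'I_N) (f : 'rV[R]_N -> R) : 'rV[R]_N -> R :=
  'D_(delta_mx 0 i) f.

Definition partial_ex (i : 'I_N) (f : 'rV[R]_N -> R) (x : 'rV[R]_N) : Prop :=
  derivable f x (delta_mx 0 i).

Definition laplacian (f : 'rV[R]_N -> R) (x : 'rV[R]_N) : R :=
  \sum_(i < N) partial i (partial i f) x.

(* Radially symmetric is the case [enorm x = enorm y]. For functions that are
   only continuous, "u_0'(r) <= 0" means nonincreasing in r. *)
Definition radially_decreasing (f : 'rV[R]_N -> R) : Prop :=
  forall x y, closed_unit_ball x -> closed_unit_ball y ->
    enorm x <= enorm y -> f y <= f x.

Definition C21 (T : R) (u : 'rV[R]_N -> R -> R) : Prop :=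
  let Q := [set p : 'rV[R]_N * R | unit_ball p.1 /\ 0 < p.2 < T] in
  [/\ forall p, Q p -> derivable (u p.1) p.2 1,
      forall p, Q p -> {for p, continuous (fun q : 'rV[R]_N * R =>
        derive1 (u q.1) q.2)},
      forall p i, Q p -> partial_ex i (u ^~ p.2) p.1 /\
        {for p, continuous (fun q : 'rV[R]_N * R => partial i (u ^~ q.2) q.1)}
    & forall p i j, Q p -> partial_ex j (partial i (u ^~ p.2)) p.1 /\
        {for p, continuous (fun q : 'rV[R]_N * R =>
          partial j (partial i (u ^~ q.2)) q.1)}].

Definition nonlocal_source (lambda : R) (v : 'rV[R]_N -> R) (x : 'rV[R]_N) : R :=
  lambda / ((1 - v x) ^+ 2 * (1 + ball_integral (fun y => (1 - v y)^-1)) ^+ 2).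

(* Continuity is not required at the corner [unit_sphere `*` [set 0]], since
   the initial datum need not vanish on the boundary. *)
Definition is_solution (lambda T : R) (u0 : 'rV[R]_N -> R)
    (u : 'rV[R]_N -> R -> R) : Prop :=
  [/\ C21 T u,
      {within [set p : 'rV[R]_N * R | closed_unit_ball p.1 /\ 0 <= p.2 < T /\
                 ~ (unit_sphere p.1 /\ p.2 = 0)],
        continuous (fun p : 'rV[R]_N * R => u p.1 p.2)},
      forall x t, closed_unit_ball x -> 0 < t < T -> u x t < 1
    & [/\ forall x t, unit_ball x -> 0 < t < T ->
          derive1 (u x) t - laplacian (u ^~ t) x = nonlocal_source lambda (u ^~ t) x,
        forall x t, unit_sphere x -> 0 < t < T -> u x t = 0
      & forall x, unit_ball x -> u x 0 = u0 x]].

Definition quenches_at (Tq : R) (u : 'rV[R]_N -> R -> R) : Prop :=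
  exists (xstar : 'rV[R]_N) (x : nat -> 'rV[R]_N) (t : nat -> R),
    [/\ forall n, unit_ball (x n) /\ 0 < t n < Tq,
        x n @[n --> \oo] --> xstar,
        t n @[n --> \oo] --> Tq
      & u (x n) (t n) @[n --> \oo] --> 1^'-].

Definition ball_max (f : 'rV[R]_N -> R) : R := sup (f @` closed_unit_ball).

End pde_notions.

(* Main.v *)
(** The profile u(., t) is maximal at the interior point 0, so its Laplacian is
    nonpositive there. As the nonlocal factor is at least 1, the equation gives
    (1 - M)^2 M' <= lambda, i.e. (1 - M(t))^3 + 3 lambda t is nondecreasing.
    Comparing its value at t with its values along the quenching sequence, where
    M tends to 1, yields (1 - M(t))^3 <= 3 lambda (Tq - t). *)
Require Import Defs.
From mathcomp Require Import all_boot all_order all_algebra.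
From mathcomp Require Import all_classical all_reals all_analysis.
From mathcomp Require Import ring.
Import Order.TTheory GRing.Theory Num.Theory.
Import numFieldNormedType.Exports.
Local Open Scope classical_set_scope.
Local Open Scope ring_scope.

Section derivatives_along_lines.
Context {R : realType}.

(** Second-derivative test with [g'] differentiable at 0 only. Since [g'(0) = 0], a positive
    [g''(0)] would make [g' > 0] just to the right of 0, and the mean value theorem would give
    [g b > g 0]. *)
Lemma derive1_derive1_at_max_le0 (g : R -> R) (r : R) :
  0 < r -> (forall h, `|h| < r -> derivable g h 1) ->
  (forall h, `|h| < r -> g h <= g 0) ->
  derivable (derive1 g) 0 1 -> derive1 (derive1 g) 0 <= 0.
Proof.
move=> r0 dg gmax ddg.
have itvN h : h \in `](- r), r[ -> `|h| < r by rewrite in_itv/= ltr_norml.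
have g'0 : derive1 g 0 = 0.
  rewrite derive1E; apply/derive_val.
  apply: (@derive1_at_max _ g (- r) r 0) => [|h /itvN/dg//||h /itvN/gmax//].
    by rewrite ge0_cp// ltW.
  by rewrite in_itv/= r0 oppr_lt0 r0.
rewrite leNgt; apply/negP => g''0.
have /cvgr_gt/(_ _ g''0)/nbhs_ballP[e/= e0 g'gt0] :
    h^-1 *: (derive1 g (h *: 1 + 0) - derive1 g 0) @[h --> 0^'] --> derive1 (derive1 g) 0.
  by rewrite [X in _ --> X]derive1E; exact: ddg.
(* Halving keeps [b] strictly below both [e], where the quotient of [g'] is positive, and [r], where
   [g] is differentiable and at most [g 0]. *)
pose b := Num.min e r / 2.
have m0 : 0 < Num.min e r by rewrite lt_min e0 r0.
have b0 : 0 < b by rewrite divr_gt0.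
have bm : b < Num.min e r by rewrite ltr_pdivrMr// mulr2n mulrDr mulr1 ltrDl.
have [be br] : b < e /\ b < r by move: bm; rewrite lt_min => /andP[].
have dgb h : 0 <= h <= b -> derivable g h 1.
  by move=> /andP[h0 hb]; apply: dg; rewrite ger0_norm// (le_lt_trans hb).
have [||c] := @MVT _ g (derive1 g) 0 b b0.
- move=> h; rewrite in_itv/= => /andP[h0 hb].
  by rewrite derive1E; apply/derivableP/dgb; rewrite !ltW.
- by apply: derivable_within_continuous => h; rewrite in_itv/=; exact: dgb.
rewrite in_itv/= => /andP[c0 cb] gbE.
have := g'gt0 c; rewrite -ball_normE /= g'0 sub0r normrN gtr0_norm// addr0 subr0.
move=> /(_ (lt_trans cb be) (lt0r_neq0 c0)).
rewrite /GRing.scale/= mulr1 pmulr_rgt0 ?invr_gt0// => g'c.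
have : g b <= g 0 by apply: gmax; rewrite gtr0_norm.
by rewrite -subr_le0 gbE leNgt subr0 mulr_gt0.
Qed.

Context {V : normedModType R}.
Implicit Types (f : V -> R) (v : V).

(** Both difference quotients are the same function of [k], so existence and value of the derivative
    transfer by rewriting, without a chain rule. *)
Let difference_quotient_line f v (h : R) :
  (fun k : R => k^-1 *: (((fun h : R => f (h *: v)) \o shift h) (k *: 1)
     - f (h *: v))) =
  (fun k : R => k^-1 *: ((f \o shift (h *: v)) (k *: v) - f (h *: v))).
Proof.
by apply/funext => k /=; rewrite scalerDl /GRing.scale/= mulr1.
Qed.

Lemma derivable_line f v (h : R) :
  derivable f (h *: v) v -> derivable (fun h : R => f (h *: v)) h 1.
Proof. by rewrite /derivable difference_quotient_line. Qed.

Lemma derive1_line f v :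
  derive1 (fun h : R => f (h *: v)) = (fun h : R => 'D_v f (h *: v)).
Proof.
by apply/funext => h; rewrite derive1E /derive difference_quotient_line.
Qed.

End derivatives_along_lines.

Section unit_ball.
Context {R : realType} {N : nat}.

Lemma enorm0 : enorm (0 : 'rV[R]_N) = 0.
Proof.
by rewrite /enorm big1 ?sqrtr0// => i _; rewrite mxE expr0n.
Qed.

Lemma enormZ_delta (i : 'I_N) (h : R) : enorm (h *: delta_mx 0 i) = `|h|.
Proof.
rewrite /enorm (bigD1 i)//= big1 => [|j /negbTE ji].
  by rewrite !mxE !eqxx mulr1 addr0 sqrtr_sqr.
by rewrite !mxE ji andbF mulr0 expr0n.
Qed.

(** Along each coordinate axis [f] has a maximum at 0, so the one-variable test bounds every term of
    the sum. *)
Lemma laplacian_at_max_le0 (f : 'rV[R]_N -> R) :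
  (forall x i, unit_ball x -> partial_ex i f x) ->
  (forall i, partial_ex i (partial i f) 0) ->
  (forall x, unit_ball x -> f x <= f 0) ->
  laplacian f 0 <= 0.
Proof.
move=> df ddf fmax; apply: sumr_le0 => i _.
pose g (h : R) := f (h *: delta_mx 0 i).
have ball_line (h : R) : `|h| < 1 -> unit_ball (h *: delta_mx 0 i : 'rV[R]_N).
  by rewrite /unit_ball/= enormZ_delta.
have dgE : derive1 g = (fun h : R => partial i f (h *: delta_mx 0 i)).
  exact: derive1_line.
have -> : partial i (partial i f) 0 = derive1 (derive1 g) 0.
  by rewrite dgE derive1_line scale0r.
apply: (@derive1_derive1_at_max_le0 _ _ 1) => // [h /ball_line h1|h /ball_line h1|].
- exact/derivable_line/df.
- by rewrite /g scale0r; exact: fmax.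
- rewrite dgE; apply: derivable_line.
  by rewrite scale0r; exact: ddf.
Qed.

Lemma ball_max_radially_decreasing (f : 'rV[R]_N -> R) :
  radially_decreasing f -> ball_max f = f 0.
Proof.
move=> fdec; have cl0 : closed_unit_ball (0 : 'rV[R]_N).
  by rewrite /closed_unit_ball/= enorm0.
have f0ub : ubound (f @` closed_unit_ball (N := N)) (f 0).
  by move=> _ [x x1 <-]; apply: fdec => //; rewrite enorm0 sqrtr_ge0.
have im0 : (f @` closed_unit_ball (N := N)) (f 0) by exists 0.
apply/eqP; rewrite eq_le; apply/andP; split; first by apply: ge_sup => //; exists (f 0).
by apply: ub_le_sup => //; exists (f 0).
Qed.

Lemma nonlocal_source_le (lambda : R) (v : 'rV[R]_N -> R) (x : 'rV[R]_N) :
  0 <= lambda -> (forall y, unit_ball y -> v y < 1) -> unit_ball x ->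
  nonlocal_source lambda v x <= lambda / (1 - v x) ^+ 2.
Proof.
move=> l0 v1 x1; rewrite /nonlocal_source ler_wpM2l//.
(* This holds even if the integral diverges: the real-valued integral is then 0 by convention. *)
have I0 : 0 <= ball_integral (fun y => (1 - v y)^-1).
  apply: Rintegral_ge0 => z /= z1.
  by rewrite invr_ge0 subr_ge0 ltW// v1.
have vx0 : 0 < 1 - v x by rewrite subr_gt0 v1.
have I1 : 1 <= 1 + ball_integral (fun y => (1 - v y)^-1) by rewrite lerDl.
have v0 := exprn_gt0 2 vx0; have II0 := exprn_gt0 2 (lt_le_trans ltr01 I1).
rewrite lef_pV2 ?posrE ?(mulr_gt0 v0 II0)//.
by rewrite ler_peMr ?exprn_ege1 ?(ltW v0).
Qed.

End unit_ball.

Theorem theorem4p5 (R : realType) (N : nat) (lambda Tq : R)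
    (u0 : 'rV[R]_N -> R) (u : 'rV[R]_N -> R -> R) :
  (1 <= N)%N -> 0 < lambda ->
  {within closed_unit_ball (N := N), continuous u0} ->
  (forall x, closed_unit_ball x -> 0 <= u0 x < 1) ->
  radially_decreasing u0 ->
  0 < Tq ->
  is_solution lambda Tq u0 u ->
  (forall t, 0 < t < Tq -> radially_decreasing (u ^~ t)) ->
  quenches_at Tq u ->
  exists2 C : R, 0 < C & forall t, 0 < t < Tq ->
    ball_max (u ^~ t) = u 0 t /\
    ball_max (u ^~ t) >= 1 - C * (Tq - t) `^ (3%:R^-1).
Proof.
move=> _ l0 _ _ _ Tq0 [[du _ pu ppu] _ u1 [pde _ _]] udec [_ [x [t [xt _ tTq uxt]]]].
have ball0 : unit_ball (0 : 'rV[R]_N) by rewrite /unit_ball/= enorm0.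
have ballW y : unit_ball y -> closed_unit_ball (y : 'rV[R]_N) by exact: ltW.
have umax s y : 0 < s < Tq -> unit_ball y -> u y s <= u 0 s.
  move=> sTq y1; apply: udec => //; [exact: ballW|exact: ballW|].
  by rewrite enorm0 sqrtr_ge0.
have u0d s : 0 < s < Tq -> derivable (u 0) s 1 by move=> sTq; exact: (du (0, s)).
have u0lt s : 0 < s < Tq -> 0 < 1 - u 0 s.
  by move=> sTq; rewrite subr_gt0 u1//; exact: ballW.
have u0' s : 0 < s < Tq -> (1 - u 0 s) ^+ 2 * derive1 (u 0) s <= lambda.
  move=> sTq; rewrite mulrC -ler_pdivlMr ?exprn_gt0 ?u0lt//.
  have u1s y : unit_ball y -> u y s < 1 by move=> y1; apply: u1 => //; exact: ballW.
  (* It remains to bound the time derivative by the source at the origin, which by the equation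
     means that the Laplacian there is nonpositive. *)
  apply: (le_trans _ (@nonlocal_source_le _ _ _ (u ^~ s) 0 (ltW l0) u1s ball0)).
  rewrite -pde// lerBrDr gerDl; apply: laplacian_at_max_le0.
  - by move=> y i y1; have [] := pu (y, s) i.
  - by move=> i; have [] := ppu (0, s) i i.
  - by move=> y; exact: umax.
(* The inequality [u0'] integrated in time; the factor 3 comes from differentiating the cube. *)
pose F (s : R) := (1 - u 0 s) ^+ 3 + 3 * lambda * s.
have F' s : 0 < s < Tq ->
    is_derive s 1 F (3 * (lambda - (1 - u 0 s) ^+ 2 * derive1 (u 0) s)).
  move=> sTq; have := derivableP (u0d _ sTq); rewrite -derive1E => u0s.
  by rewrite /F; apply: is_derive_eq; rewrite /GRing.scale/=; ring.
have F_mono s1 s2 : 0 < s1 < Tq -> 0 < s2 < Tq -> s1 <= s2 -> F s1 <= F s2.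
  move=> /andP[s10 _] /andP[_ s2T] s12.
  have in_Tq s : s1 <= s <= s2 -> 0 < s < Tq.
    by move=> /andP[a b]; rewrite (lt_le_trans s10)// (le_lt_trans b).
  have dF s : s1 <= s <= s2 -> derivable F s 1.
    by move=> /in_Tq/F'[].
  apply: (@ger0_derive1_ndecr _ F s1 s2) => //.
  - by move=> s; rewrite in_itv/= => /andP[? ?]; apply: dF; rewrite !ltW.
  - move=> s; rewrite in_itv/= => /andP[? ?].
    have sTq : 0 < s < Tq by apply: in_Tq; rewrite !ltW.
    have ? := F' s sTq.
    by rewrite derive1E derive_val mulr_ge0// subr_ge0 u0'.
  - by apply: derivable_within_continuous => s; rewrite in_itv/=; exact: dF.
have cube_le s : 0 < s < Tq -> (1 - u 0 s) ^+ 3 <= 3 * lambda * (Tq - s).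
  move=> sTq.
  have uxt1 : u (x n) (t n) @[n --> \oo] --> (1 : R).
    by apply: cvg_trans uxt _; exact: cvg_within.
  rewrite mulrBr lerBrDr -/(F s).
  have -> : 3 * lambda * Tq = (1 - 1) ^+ 3 + 3 * lambda * Tq by ring.
  (* The limit is taken along [u (x n) (t n)], whose convergence to 1 is given, rather than along
     [u 0 (t n)]. *)
  have FTq : (1 - u (x n) (t n)) ^+ 3 + 3 * lambda * t n @[n --> \oo] -->
      (1 - 1) ^+ 3 + 3 * lambda * Tq.
    apply: cvgD; last exact: cvgMr.
    apply: (@cvg_comp _ _ _ (fun n => 1 - u (x n) (t n)) (fun y => y ^+ 3)).
      by apply: cvgB uxt1; exact: cvg_cst.
    exact: exprn_continuous.
  apply: (cvgr_to_ge FTq).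
  have /andP[_ sT] := sTq.
  (* Eventually [s <= t n], so [F s <= F (t n)]; passing from 0 to [x n] lowers [u] and hence only
     increases the cube. *)
  near=> n; have [xn tn] := xt n.
  apply: (@le_trans _ _ (F (t n))).
    by apply: F_mono => //; near: n; exact: (cvgr_ge _ tTq).
  by rewrite lerD2r lerXn2r ?nnegrE ?subr_ge0 ?lerB ?umax// ltW// u1//; exact: ballW.
(* The constant is what the cube root of [cube_le] produces. *)
exists ((3 * lambda) `^ 3^-1) => [|s sTq]; first by apply: powR_gt0; rewrite mulr_gt0.
rewrite ball_max_radially_decreasing; last exact: udec.
split=> //; have /andP[_ sT] := sTq.
have l3 : 0 <= 3 * lambda by rewrite mulr_ge0// ltW.
have Ts : 0 <= Tq - s by rewrite subr_ge0 ltW.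
have u0s := ltW (u0lt _ sTq).
rewrite lerBlDr -lerBlDl -powRM//.
(* With the left side written as a cube root, monotonicity of the power reduces the goal to
   [cube_le]. *)
have -> : 1 - u 0 s = ((1 - u 0 s) ^+ 3) `^ 3^-1.
  by rewrite -powR_mulrn// -powRrM mulfV// powRr1.
by rewrite ge0_ler_powR ?nnegrE ?invr_ge0 ?exprn_ge0 ?(mulr_ge0 l3 Ts) ?cube_le.
Unshelve. all: by end_near.
Qed.
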